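(* Let $p\ge3$ and $\lambda=\lambda_p=2\cos(\pi/p)$. Suppose $W_1$ and $W_2$ are products of conjugacy class generators in $G_p$ whose conjugacy classes are primitive hyperbolic, with associated ISPs $P_{\mathcal A_1}$ and $P_{\mathcal A_2}$ respectively. Then $P_{\mathcal A_1}$ and $P_{\mathcal A_2}$ are Hecke-conjugate ISPs (i.e. $P_{\mathcal A_1}'=P_{\mathcal A_2}$) if and only if $W_1^{\top}$ is a cyclic permutation of $W_2$; here if $W_1=V_{j_1}V_{j_2}\cdots V_{j_n}$ then $W_1^{\top}$ is the generator product $V_{p-j_n}V_{p-j_{n-1}}\cdots V_{p-j_1}$.
   Context: Let $S=\begin{pmatrix}1&\lambda\\0&1\end{pmatrix}$, $T=\begin{pmatrix}0&-1\\1&0\end{pmatrix}$, $U=ST$, $G_p=\langle S,T\rangle/\{\pm I\}$ acting by Möbius transformations; elements represented by matrices of positive trace; hyperbolic: $|\mathrm{tr}|>2$; primitive: not a $k$-th power, $k\ge2$. Conjugacy class generators: $V_j=U^{j-1}S$, $1\le j\le p-1$; every non-elliptic element is conjugate to a product of $V_j$'s unique up to cyclic permutation. A hyperbolic number is a fixed point of a hyperbolic element; its Hecke-conjugate $\alpha'$ is the other fixed point; $R'=\{x':x\in R\}$. A $\lambda$-BQF is $Ax^2+Bxy+Cy^2$ with coefficients in $\mathbb Z[\lambda]$, with $G_p$-action $(Q\circ M)(x,y)=Q(ax+by,cx+dy)$ and induced equivalence. For primitive hyperbolic $M=\begin{pmatrix}a&b\\c&d\end{pmatrix}$ of positive trace,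 $Q_M=[c,d-a,-b]$; for hyperbolic $\alpha$, $Q_\alpha=Q_{M_\alpha}$ with $M_\alpha$ the primitive hyperbolic element whose attracting fixed point is $\alpha$. $\alpha$ is simple if $\alpha'<0<\alpha$. For a class $\mathcal A$, $\mathcal Z_{\mathcal A}=\{\alpha\text{ simple}:Q_\alpha\in\mathcal A\}$ and its ISP (irreducible system of poles of rational period functions on $G_p$) is $P_{\mathcal A}=\mathcal Z_{\mathcal A}\cup T\mathcal Z_{\mathcal A}$. The ISP associated with a primitive hyperbolic element $W$ is $P_{\mathcal A}$ where $\mathcal A$ is the class of forms containing $Q_M$ for $M$ conjugate to $W$. *)

(* Defs.v *)
From HB Require Import structures.
From mathcomp Require Import all_boot all_order all_algebra.
From mathcomp Require Import all_classical all_reals all_analysis.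
From mathcomp Require Import ring.

Set Implicit Arguments.
Unset Strict Implicit.
Unset Printing Implicit Defensive.

Import Order.TTheory GRing.Theory Num.Theory.
Import numFieldNormedType.Exports.
Local Open Scope classical_set_scope.
Local Open Scope ring_scope.

Section Hecke.
Variable R : realType.
Implicit Types (p k : nat) (M N : 'M[R]_2) (w : seq nat) (x : R).

Definition mx22 (a b c d : R) : 'M[R]_2 :=
  \matrix_(i < 2, j < 2)
    if i == 0 then (if j == 0 then a else b) else (if j == 0 then c else d).

Definition lam p : R := 2 * cos (pi / p%:R).

Definition Smx p : 'M[R]_2 := mx22 1 (lam p) 0 1.
Definition Tmx : 'M[R]_2 := mx22 0 (-1) 1 0.
Definition Umx p : 'M[R]_2 := Smx p * Tmx.

(* The matrix group <S, T>.  An element of G_p = <S, T> / {I, -I} is given by  *)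
(* either of its two matrix representatives, so that equality in G_p is eqpm.  *)
Inductive hecke p : 'M[R]_2 -> Prop :=
| hecke1 : hecke p 1
| heckeS : hecke p (Smx p)
| heckeT : hecke p Tmx
| heckeM M N : hecke p M -> hecke p N -> hecke p (M * N)
| heckeV M : hecke p M -> hecke p M^-1.

Definition eqpm M N : Prop := M = N \/ M = - N.

Definition hecke_conj p M N : Prop :=
  exists2 g, hecke p g & eqpm M (g * N * g^-1).

Definition hyperbolic M : Prop := 2 < `|\tr M|.

Definition primitive p M : Prop :=
  forall k N, (2 <= k)%N -> hecke p N -> ~ eqpm M (N ^+ k).

Definition Vmx p (j : nat) : 'M[R]_2 := Umx p ^+ (j - 1) * Smx p.

(* A generator product V_{j_1} ... V_{j_n} is encoded by its word of indices.  *)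
Definition gen_word p w : bool := all (fun j => (1 <= j <= p - 1)%N) w.
Definition gen_prod p w : 'M[R]_2 := \prod_(j <- w) Vmx p j.
Definition word_tr p w : seq nat := rev [seq (p - j)%N | j <- w].
Definition cyclic_perm (w1 w2 : seq nat) : Prop := exists k, w1 = rot k w2.

Definition moebius M x : R := (M 0 0 * x + M 0 1) / (M 1 0 * x + M 1 1).

(* The denominator condition excludes the junk value of division by zero,      *)
(* which stands for the image point at infinity.                               *)
Definition fixed_pt M x : Prop :=
  M 1 0 * x + M 1 1 != 0 /\ moebius M x = x.

Definition attracting M x : Prop :=
  fixed_pt M x /\ `|derive1 (moebius M) x| < 1.

(* y is the Hecke-conjugate x' of the hyperbolic number x.                     *)
Definition Hconj p (x y : R) : Prop :=
  exists M, [/\ hecke p M, hyperbolic M, fixed_pt M x, fixed_pt M y & y != x].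

Definition Hconj_set p (P : set R) : set R :=
  [set y | exists2 x, P x & Hconj p x y].

Definition simple_num p x : Prop := exists2 y, Hconj p x y & y < 0 < x.

Record bqf := Bqf { bqA : R; bqB : R; bqC : R }.

Definition bqf_eval (Q : bqf) (x y : R) : R :=
  bqA Q * x ^+ 2 + bqB Q * x * y + bqC Q * y ^+ 2.

Definition Zlam p : set R :=
  [set x | exists q : {poly int}, x = (map_poly intr q).[lam p]].

Definition lam_bqf p (Q : bqf) : Prop :=
  [/\ Zlam p (bqA Q), Zlam p (bqB Q) & Zlam p (bqC Q)].

(* Q o M, characterized by bqf_act_eval below.                                 *)
Definition bqf_act (Q : bqf) M : bqf :=
  let: Bqf A B C := Q in
  let a := M 0 0 in let b := M 0 1 in let c := M 1 0 in let d := M 1 1 in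
  Bqf (A * a ^+ 2 + B * a * c + C * c ^+ 2)
      (2 * A * a * b + B * (a * d + b * c) + 2 * C * c * d)
      (A * b ^+ 2 + B * b * d + C * d ^+ 2).

Lemma bqf_act_eval (Q : bqf) M x y :
  bqf_eval (bqf_act Q M) x y =
  bqf_eval Q (M 0 0 * x + M 0 1 * y) (M 1 0 * x + M 1 1 * y).
Proof. by case: Q => A B C; rewrite /bqf_eval /=; ring. Qed.

Definition bqf_equiv p (Q1 Q2 : bqf) : Prop :=
  exists2 M, hecke p M & Q2 = bqf_act Q1 M.

Definition form_class p (A : set bqf) : Prop :=
  exists2 Q, lam_bqf p Q & A = [set Q' | lam_bqf p Q' /\ bqf_equiv p Q Q'].

(* Q_M depends on the sign of M; it is only used for M of positive trace.      *)
Definition Qmx M : bqf := Bqf (M 1 0) (M 1 1 - M 0 0) (- M 0 1).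

(* M is the positive-trace representative of M_x.                              *)
Definition is_Mnum p x M : Prop :=
  [/\ hecke p M, 0 < \tr M, hyperbolic M, primitive p M & attracting M x].

Definition Zset p (A : set bqf) : set R :=
  [set x | simple_num p x /\ exists2 M, is_Mnum p x M & A (Qmx M)].

Definition ISP p (A : set bqf) : set R := Zset p A `|` moebius Tmx @` Zset p A.

Definition assoc_class p (W : 'M[R]_2) (A : set bqf) : Prop :=
  form_class p A /\
  exists M, [/\ hecke p M, hecke_conj p M W, 0 < \tr M & A (Qmx M)].

End Hecke.

(* Main.v *)
(** The matrices V_j = U^j T^-1 have nonnegative entries, and the transpose of
    V_j is V_(p-j); hence the generator product of word_tr w is the transpose
    of that of w. For M of determinant 1 the transpose equals T M^-1 T^-1, and
    T M^-1 T^-1 attracts to T x' when M attracts to x. So the Hecke-conjugate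
    of the ISP of W1 is the ISP of the transpose of W1, and the claim reduces
    to showing that an ISP determines the conjugacy class of its primitive
    element, and that conjugate generator products have cyclically equivalent
    words.
    Both rest on positivity. The V_j map the positive quadrant into disjoint
    cones, so they generate a free monoid, and every element of the Hecke
    group is +- T^e V_w T^f. A hyperbolic element with attracting fixed point
    x > 0 and x' < 0 is +- a positive matrix, hence +- V_w. Two generator
    products fixing the same x > 0 have commuting words by disjointness of the
    cones; this gives uniqueness of the Hecke-conjugate and of the primitive
    element attached to x. Finally V_w g = +- g V_v with g in the normal form
    becomes an equation of words, which forces w to be a rotation of v. *)

Require Import Defs.
From HB Require Import structures.
From mathcomp Require Import all_boot all_order all_algebra.
From mathcomp Require Import all_classical all_reals all_analysis.
From mathcomp Require Import ring lra zify.

Set Implicit Arguments.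
Unset Strict Implicit.
Unset Printing Implicit Defensive.

Import Order.TTheory GRing.Theory Num.Theory.
Import numFieldNormedType.Exports.
Local Open Scope classical_set_scope.
Local Open Scope ring_scope.

(** * Two-by-two matrices of determinant 1, and equality up to sign *)

Section Matrix2.
Variable R : realType.
Implicit Types (M N g : 'M[R]_2) (a b c d : R).

Lemma mx22E a b c d :
  ((mx22 a b c d 0 0 = a) * (mx22 a b c d 0 1 = b) *
   (mx22 a b c d 1 0 = c) * (mx22 a b c d 1 1 = d))%type.
Proof. by rewrite !mxE. Qed.

Lemma mx2P M N : M 0 0 = N 0 0 -> M 0 1 = N 0 1 -> M 1 0 = N 1 0 ->
  M 1 1 = N 1 1 -> M = N.
Proof.
move=> h00 h01 h10 h11; apply/matrixP => i j.
by case: (unliftP 0 i) => [i'|] ->; case: (unliftP 0 j) => [j'|] -> //;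
  rewrite ?(ord1 i') ?(ord1 j'); [move: h11|move: h10|move: h01];
  congr (M _ _ = N _ _); apply/val_inj.
Qed.

Lemma mul2E M N i j : (M * N) i j = M i 0 * N 0 j + M i 1 * N 1 j.
Proof. by rewrite mxE !big_ord_recl big_ord0 addr0; congr (_ + M _ _ * N _ _); apply/val_inj. Qed.

Lemma opp2E M i j : (- M) i j = - M i j. Proof. by rewrite mxE. Qed.

Lemma one2E : ((((1 : 'M[R]_2) 0 0 = 1) * ((1 : 'M[R]_2) 0 1 = 0)) *
  (((1 : 'M[R]_2) 1 0 = 0) * ((1 : 'M[R]_2) 1 1 = 1)))%type.
Proof. by rewrite !mxE. Qed.

Lemma det2E M : \det M = M 0 0 * M 1 1 - M 0 1 * M 1 0.
Proof.
rewrite (expand_det_row _ 0) !big_ord_recl big_ord0 addr0 /cofactor !det_mx11 !mxE /=.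
rewrite expr0 mul1r expr1 mulN1r mulrN.
by congr (_ * M _ _ - M _ _ * M _ _); apply/val_inj.
Qed.

Lemma tr2E M : \tr M = M 0 0 + M 1 1.
Proof. by rewrite /mxtrace !big_ord_recl big_ord0 addr0; congr (_ + M _ _); apply/val_inj. Qed.

Lemma det1_unit M : \det M = 1 -> M \is a GRing.unit.
Proof. by move=> h; rewrite unitmxE h unitr1. Qed.

Lemma inv2E M : \det M = 1 -> M^-1 = mx22 (M 1 1) (- M 0 1) (- M 1 0) (M 0 0).
Proof.
move=> h; apply: (mulrI (det1_unit h)); rewrite mulrV ?det1_unit //.
by move: h; rewrite det2E => h; apply: mx2P; rewrite mul2E !mx22E !one2E -?h; ring.
Qed.

Lemma trmx2M M N : (M * N)^T = N^T * M^T. Proof. exact: trmx_mul. Qed.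

Lemma det_Tmx : \det (Tmx R) = 1.
Proof. by rewrite det2E !mx22E; ring. Qed.

(* Conjugation by T turns the inverse into the transpose. *)
Lemma Tmx_conjV M : \det M = 1 -> Tmx R * M^-1 * (Tmx R)^-1 = M^T.
Proof.
by move=> h; apply: mx2P; rewrite (inv2E h) (inv2E det_Tmx) !mul2E !mx22E !mxE; ring.
Qed.

Lemma det2M M N : \det (M * N) = \det M * \det N. Proof. exact: det_mulmx. Qed.

Lemma tr_conj M g : \det g = 1 -> \tr (g * M * g^-1) = \tr M.
Proof.
move=> h; have := mxtrace_mulC (g * M) g^-1; rewrite -!mulmxE => ->.
by rewrite !mulmxE mulrA mulVr ?det1_unit // mul1r.
Qed.

Lemma eqpm_sym M N : eqpm M N -> eqpm N M.
Proof. by case=> ->; [left|right; rewrite opprK]. Qed.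

Lemma eqpm_trans M N g : eqpm M N -> eqpm N g -> eqpm M g.
Proof. by case=> -> [] ->; rewrite ?opprK; [left|right|right|left]. Qed.

Lemma eqpmM M N M' N' : eqpm M M' -> eqpm N N' -> eqpm (M * N) (M' * N').
Proof. by case=> -> [] ->; rewrite ?mulrN ?mulNr ?opprK; [left|right|right|left]. Qed.

Lemma eqpmNl M N : eqpm (- M) N -> eqpm M N.
Proof. by case=> E; [right|left]; rewrite -?E ?opprK //; apply: oppr_inj. Qed.

Lemma eqpmMlr M' N' M N : eqpm M N -> eqpm (M' * M * N') (M' * N * N').
Proof. by case=> ->; [left|right]; rewrite ?mulrN ?mulNr. Qed.

End Matrix2.

(** * Commuting and conjugate words *)

Section Words.

(** Euclid's algorithm on the lengths: the shorter word is a prefix of the longer one, and what is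
    left after removing it still commutes with it. *)
Lemma cat_comm_pow (T : eqType) (w v : seq T) : w ++ v = v ++ w ->
  exists u a b, w = flatten (nseq a u) /\ v = flatten (nseq b u).
Proof.
have [n] := ubnP (size w + size v); elim: n w v => // n IH w v.
wlog lewv : w v / (size w <= size v)%N.
  move=> H hn e; case: (leqP (size w) (size v)) => [h|/ltnW h]; first exact: H.
  rewrite addnC in hn; have [u [a [b [? ?]]]] := H v w h hn (esym e).
  by exists u, b, a.
case: w lewv => [|x w] lewv hn e; first by exists v, 0%N, 1%N; rewrite /= cats0.
set W := x :: w in lewv hn e *.
have hv : v = W ++ drop (size W) v.
  rewrite -{1}(cat_take_drop (size W) v); congr (_ ++ _).
  by have := congr1 (take (size W)) e; rewrite take_size_cat // takel_cat.
move: (drop _ v) hv => v' hv.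
have e' : W ++ v' = v' ++ W.
  by move: e; rewrite hv -[(W ++ v') ++ W]catA => /eqP; rewrite eqseq_cat // eqxx => /eqP.
have [|u [a [b [eW ev]]]] := IH W v' _ e'.
  by move: hn; rewrite hv size_cat /W /=; lia.
by exists u, a, (a + b)%N; rewrite hv nseqD flatten_cat -eW -ev.
Qed.

(** If [u] is no longer than [w], then [w = u ++ s] and [v = s ++ u]. Otherwise [w] is a prefix of
    [u], and removing it gives the same equation with a shorter [u]. *)
Lemma conj_word_rot (T : eqType) (w u v : seq T) : w ++ u = u ++ v ->
  exists k, w = rot k v.
Proof.
have [n] := ubnP (size u); elim: n u => // n IH u hn e.
have sz : size w = size v by have := congr1 size e; rewrite !size_cat; lia.
case: (leqP (size u) (size w)) => h.
  have hw : w = u ++ drop (size u) w.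
    rewrite -{1}(cat_take_drop (size u) w); congr (_ ++ _).
    by have := congr1 (take (size u)) e; rewrite takel_cat // take_size_cat.
  set s := drop _ w in hw; move: e; rewrite hw -catA => /eqP.
  rewrite eqseq_cat // eqxx /= => /eqP <-.
  by exists (size s); rewrite rot_size_cat.
have hu : u = w ++ drop (size w) u.
  rewrite -{1}(cat_take_drop (size w) u); congr (_ ++ _).
  by have := congr1 (take (size w)) e; rewrite take_size_cat // takel_cat // ltnW.
move: (drop _ u) hu => s hu; move: e; rewrite hu -catA => /eqP.
rewrite eqseq_cat // eqxx /= => /eqP e'.
case: w h hu sz e' {IH} (IH s) => [|x w] h hu sz e' IH.
  by exists 0%N; rewrite rot0; apply/esym/size0nil.
by apply: IH; rewrite // -ltnS; apply: leq_trans hn; rewrite hu size_cat /=; lia.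
Qed.

Lemma gen_word_cat p w v : gen_word p (w ++ v) = gen_word p w && gen_word p v.
Proof. exact: all_cat. Qed.

Lemma gen_word_tr p w : gen_word p w -> gen_word p (word_tr p w).
Proof.
by rewrite /gen_word /word_tr all_rev all_map => h; apply: sub_all h => j /=; lia.
Qed.

End Words.

(** * The generators V_j: trigonometric entries, signs and transposes *)

Section Generators.
Variables (R : realType) (p : nat).
Hypothesis hp : (3 <= p)%N.
Implicit Types (M N g : 'M[R]_2) (w u v : seq nat).

Let theta : R := pi / p%:R.

(** Chebyshev polynomials of the second kind at cos theta, with index shifted by one; up to sign
    they are the entries of the powers of [Umx]. *)
Definition sn (n : nat) : R := sin (n%:R * theta) / sin theta.

Let p_gt0 : 0 < p%:R :> R. Proof. by rewrite ltr0n; lia. Qed.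

Let ptheta : p%:R * theta = pi.
Proof. by rewrite /theta mulrC divfK // gt_eqF. Qed.

Let theta_gt0 : 0 < theta. Proof. by rewrite divr_gt0 ?pi_gt0. Qed.

Let sin_theta_gt0 : 0 < sin theta.
Proof.
apply: sin_gt0_pi; rewrite theta_gt0 -ptheta /=.
by rewrite -{1}(mul1r theta) ltr_pM2r // (ltr_nat R 1); lia.
Qed.

Let sin_theta_neq0 : sin theta != 0. Proof. by rewrite gt_eqF. Qed.

Lemma sn0 : sn 0 = 0. Proof. by rewrite /sn mul0r sin0 mul0r. Qed.

Lemma sn1 : sn 1 = 1. Proof. by rewrite /sn mul1r divff. Qed.

Lemma snSS n : sn n.+2 = lam R p * sn n.+1 - sn n.
Proof.
have E : sin (n.+2%:R * theta) = 2 * cos theta * sin (n.+1%:R * theta) - sin (n%:R * theta).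
  have -> : n.+2%:R * theta = n.+1%:R * theta + theta by rewrite -(natr1 n.+1); ring.
  have -> : n%:R * theta = n.+1%:R * theta - theta by rewrite -(natr1 n); ring.
  by rewrite sinD sinB; ring.
by rewrite /sn /lam -/theta E; field.
Qed.

Lemma sn_sym n : (n <= p)%N -> sn (p - n) = sn n.
Proof.
move=> h; rewrite /sn natrB // mulrBl ptheta sinB sinpi cospi.
by congr (_ / _); ring.
Qed.

Lemma snp : sn p = 0. Proof. by rewrite -(sn_sym (leqnn p)) subnn sn0. Qed.

Lemma snSp : sn p.+1 = -1.
Proof.
rewrite /sn -natr1 mulrDl ptheta mul1r sinD sinpi cospi.
by field.
Qed.

(** For theta <= x <= pi - theta, the difference sin x - sin theta is twice a cosine on
    [-pi/2, pi/2] times a sine on [0, pi]. *)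
Lemma sn_ge1 n : (1 <= n <= p - 1)%N -> 1 <= sn n.
Proof.
move=> /andP[h1 h2]; rewrite /sn ler_pdivlMr // mul1r -subr_ge0.
set x := n%:R * theta.
have h1' : theta <= x by rewrite -{1}(mul1r theta) ler_pM2r // (ler_nat R 1).
have h2' : x + theta <= pi.
  rewrite -ptheta /x -{2}(mul1r theta) -mulrDl ler_pM2r // natr1 ler_nat; lia.
have -> : sin x - sin theta = 2 * cos ((x + theta) / 2) * sin ((x - theta) / 2).
  have F (a b : R) : sin (a + b) - sin (a - b) = 2 * cos a * sin b.
    by rewrite sinD sinB; ring.
  by rewrite -F; congr (sin _ - sin _); field.
have E (a b c : R) : 0 < a -> a <= b -> b + a <= c ->
    - (c / 2) <= (b + a) / 2 <= c / 2 /\ 0 <= (b - a) / 2 <= c.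
  by move=> *; split; apply/andP; split; lra.
have [Ec Es] := E _ _ _ theta_gt0 h1' h2'.
by rewrite !mulr_ge0 ?cos_ge0_pihalf ?sin_ge0_pi.
Qed.

Lemma sn_ge0 n : (n <= p)%N -> 0 <= sn n.
Proof.
case: (ltnP 0 n) => [h|]; last by rewrite leqn0 => /eqP ->; rewrite sn0.
rewrite leq_eqVlt => /predU1P[->|h']; first by rewrite snp.
by apply: le_trans ler01 (sn_ge1 _); lia.
Qed.

Lemma UmxX n : Umx R p ^+ n =
  mx22 (sn n.+1) (- sn n) (sn n) (sn n.+1 - lam R p * sn n).
Proof.
elim: n => [|n IH].
  by rewrite expr0 sn0 sn1; apply: mx2P; rewrite !mx22E !one2E; ring.
by rewrite exprSr IH; apply: mx2P; rewrite !mul2E !mx22E ?snSS; ring.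
Qed.

Lemma UmxXp : Umx R p ^+ p = -1.
Proof.
by rewrite UmxX snp snSp; apply: mx2P; rewrite opp2E !mx22E !one2E; ring.
Qed.

Lemma VmxE n : Vmx R p n.+1 = mx22 (sn n.+1) (sn n.+2) (sn n) (sn n.+1).
Proof.
rewrite /Vmx subSS subn0 UmxX.
by apply: mx2P; rewrite !mul2E !mx22E ?snSS; ring.
Qed.

Lemma VmxT j : (0 < j)%N -> Vmx R p j * Tmx R = Umx R p ^+ j.
Proof. by case: j => // j _; rewrite /Vmx subSS subn0 -mulrA -exprSr. Qed.

Lemma TmxT : Tmx R * Tmx R = -1.
Proof. by apply: mx2P; rewrite opp2E !mul2E !mx22E !one2E; ring. Qed.

Lemma invTmx : (Tmx R)^-1 = - Tmx R.
Proof.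
apply: (mulrI (det1_unit (det_Tmx R))).
by rewrite mulrV ?(det1_unit (det_Tmx R)) // mulrN TmxT opprK.
Qed.

(** V_j has diagonal entries [sn j] and off-diagonal entries [sn (j + 1)], [sn (j - 1)]. By
    [sn_sym], passing to p - j keeps the former and exchanges the latter. *)
Lemma Vmx_trmx j : (1 <= j <= p - 1)%N -> Vmx R p (p - j) = (Vmx R p j)^T.
Proof.
case: j => // j hj; have -> : (p - j.+1)%N = (p - j.+1).-1.+1 by lia.
rewrite !VmxE; have -> : (p - j.+1).-1.+1 = (p - j.+1)%N by lia.
have -> : (p - j.+1).+1 = (p - j)%N by lia.
have -> : (p - j.+1).-1 = (p - j.+2)%N by lia.
by rewrite !sn_sym ?VmxE; try lia; apply: mx2P; rewrite !mxE.
Qed.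

Lemma gen_prod_cons j w : gen_prod R p (j :: w) = Vmx R p j * gen_prod R p w.
Proof. by rewrite /gen_prod big_cons. Qed.

Lemma gen_prod_nil : gen_prod R p [::] = 1.
Proof. by rewrite /gen_prod big_nil. Qed.

Lemma gen_prod_cat w v : gen_prod R p (w ++ v) = gen_prod R p w * gen_prod R p v.
Proof. by rewrite /gen_prod big_cat. Qed.

Lemma gen_prod_pow a u : gen_prod R p (flatten (nseq a u)) = gen_prod R p u ^+ a.
Proof.
elim: a => [|a IH] /=; first by rewrite gen_prod_nil expr0.
by rewrite gen_prod_cat IH exprS.
Qed.

Lemma gen_prod_tr w : gen_word p w ->
  gen_prod R p (word_tr p w) = (gen_prod R p w)^T.
Proof.
elim: w => [_|j w IH] /=; first by rewrite /word_tr /= gen_prod_nil [(1)^T]trmx1.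
move=> /andP[hj hw]; rewrite /word_tr /= rev_cons -cats1 gen_prod_cat -/(word_tr p w).
by rewrite IH // !gen_prod_cons gen_prod_nil mulr1 Vmx_trmx // [RHS]trmx2M.
Qed.

(** Each V_j satisfies these bounds, and they survive multiplication. The bound 1 on the diagonal
    later excludes a sign between two products. *)
Lemma gen_prod_ge w : gen_word p w -> let M := gen_prod R p w in
  [/\ 1 <= M 0 0, 0 <= M 0 1, 0 <= M 1 0 & 1 <= M 1 1].
Proof.
elim: w => [_|j w IH] /=; first by rewrite gen_prod_nil !one2E.
case: j => // j /andP[hj hw]; have [ha hb hc hd] := IH hw.
rewrite gen_prod_cons VmxE !mul2E !mx22E.
have s1 := sn_ge1 hj.
have s0 : 0 <= sn j by apply: sn_ge0; lia.
have s2 : 0 <= sn j.+2 by apply: sn_ge0; lia.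
by split; nra.
Qed.

Lemma det_Smx : \det (Smx R p) = 1.
Proof. by rewrite det2E !mx22E; ring. Qed.

Lemma hecke_det M : hecke p M -> \det M = 1.
Proof.
elim=> {M} [|||M N _ h1 _ h2|M _ h].
- exact: det1.
- exact: det_Smx.
- exact: det_Tmx.
- by rewrite det2M h1 h2 mulr1.
- by rewrite inv2E // det2E !mx22E -h det2E; ring.
Qed.

Lemma heckeX M k : hecke p M -> hecke p (M ^+ k).
Proof.
move=> h; elim: k => [|k IH]; first by rewrite expr0; exact: hecke1.
by rewrite exprS; apply: heckeM.
Qed.

Lemma heckeN M : hecke p M -> hecke p (- M).
Proof. by move=> h; rewrite -mulN1r -TmxT; do !apply: heckeM => //; apply: heckeT. Qed.

Lemma hecke_gen w : hecke p (gen_prod R p w).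
Proof.
elim: w => [|j w IH]; first by rewrite gen_prod_nil; exact: hecke1.
rewrite gen_prod_cons; apply: heckeM => //; apply: heckeM; last exact: heckeS.
by apply: heckeX; apply: heckeM; [exact: heckeS | exact: heckeT].
Qed.

Lemma hecke_trmx M : hecke p M -> hecke p M^T.
Proof.
move=> h; rewrite -Tmx_conjV ?(hecke_det h) //.
by do !apply: heckeM => //; [apply: heckeT|apply: heckeV|apply: heckeV; apply: heckeT].
Qed.

Lemma det_gen w : \det (gen_prod R p w) = 1.
Proof. exact: hecke_det (hecke_gen w). Qed.

End Generators.

(** * Normal form in the Hecke group, uniqueness of words, conjugate products *)

Section NormalForm.
Variables (R : realType) (p : nat).
Hypothesis hp : (3 <= p)%N.
Implicit Types (M N g A B : 'M[R]_2) (w u v : seq nat).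

Local Notation S := (Smx R p).
Local Notation T := (Tmx R).
Local Notation U := (Umx R p).
Local Notation V := (gen_prod R p).

Lemma unitT : T \is a GRing.unit. Proof. exact: det1_unit (det_Tmx R). Qed.
Lemma unitS : S \is a GRing.unit. Proof. exact: det1_unit (det_Smx R p). Qed.
Lemma invTmx3 : T^-1 = T * T * T.
Proof. by rewrite invTmx TmxT mulN1r. Qed.

(** A word in S and T without inverses, obtained from U^p = T^2 = -1. *)
Lemma invSmx : S^-1 = T * T * T * U ^+ (p - 1).
Proof.
apply: (mulIr unitS); rewrite mulVr ?unitS //.
have -> : T * T * T * U ^+ (p - 1) * S = T * T * T * (U ^+ (p - 1) * S * T) * T^-1.
  by rewrite !mulrA mulrK ?unitT.
rewrite -[U ^+ _ * S * T]mulrA -/U -exprSr subn1 prednK ?UmxXp //; last by lia.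
by rewrite mulrN1 mulNr mulrK ?unitT // TmxT opprK.
Qed.

(* T and U have finite order, so <S, T> is generated by S and T as a monoid. *)
Lemma hecke_monoid_ind (P : 'M[R]_2 -> Prop) : P 1 ->
  (forall M, P M -> P (M * S)) -> (forall M, P M -> P (M * T)) ->
  forall M, hecke p M -> P M.
Proof.
move=> P1 PS PT M hM; rewrite -(mul1r M).
suff [h _] : (forall N, P N -> P (N * M)) /\ (forall N, P N -> P (N * M^-1)) by exact: h.
have PU k N : P N -> P (N * U ^+ k).
  move=> hN; elim: k => [|k IH]; first by rewrite expr0 mulr1.
  by rewrite exprSr /Umx !mulrA; apply/PT/PS.
elim: hM => {M} [|||M N hM [i1 i2] hN [j1 j2]|M hM [i1 i2]].
- by rewrite invr1; split=> N; rewrite mulr1.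
- split=> [|N hN]; first exact: PS.
  by rewrite invSmx mulrA; apply: PU; rewrite !mulrA; apply/PT/PT/PT.
- split=> [|N hN]; first exact: PT.
  by rewrite invTmx3 !mulrA; apply/PT/PT/PT.
- split=> L hL; first by rewrite mulrA; apply/j1/i1.
  rewrite invrM ?(det1_unit (hecke_det hM)) ?(det1_unit (hecke_det hN)) //.
  by rewrite mulrA; apply/i2/j2.
- by rewrite invrK; split.
Qed.

Lemma gen_prod1 j : V [:: j] = Vmx R p j.
Proof. by rewrite gen_prod_cons gen_prod_nil mulr1. Qed.

(** Right multiplication by S and T preserves the form. After a trailing V_j T = U^j, a factor S
    turns V_j into V_(j+1) or, for j = p - 1, removes the letter, because U^(p-1) S = T. Without a
    trailing T, the factor S = V_1 is appended. *)
Lemma hecke_normal_form M : hecke p M ->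
  exists (e f : bool) w, gen_word p w /\ eqpm M (T ^+ e * V w * T ^+ f).
Proof.
elim/hecke_monoid_ind => {M} [|M [e [f [w [hw hM]]]]|M [e [f [w [hw hM]]]]].
- by exists false, false, [::]; split=> //; left; rewrite gen_prod_nil !expr0 !mulr1.
- have E : eqpm (M * S) (T ^+ e * V w * T ^+ f * S) by apply: eqpmM => //; left.
  case: f E {hM} => E; last first.
    exists e, false, (rcons w 1%N); split.
      by rewrite /gen_word all_rcons -/(gen_word p w) hw andbT; lia.
    move: E; rewrite !expr0 !mulr1 -cats1 gen_prod_cat gen_prod1 mulrA.
    by rewrite /Vmx subnn expr0 mul1r.
  case/lastP: w hw E => [_|w j].
    rewrite gen_prod_nil mulr1; case: e => E.
      exists false, false, [:: 1%N]; split; first by rewrite /=; lia.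
      apply: eqpm_trans E _; right.
      by rewrite gen_prod1 /Vmx subnn !expr1 !expr0 !mul1r mulr1 TmxT mulN1r.
    exists true, false, [:: 1%N]; split; first by rewrite /=; lia.
    apply: eqpm_trans E _; left.
    by rewrite gen_prod1 /Vmx subnn !expr1 !expr0 !mul1r mulr1.
  rewrite /gen_word all_rcons -/(gen_word p w) => /andP[hj hw].
  rewrite -cats1 gen_prod_cat gen_prod1 expr1 mulrA.
  rewrite -[X in eqpm _ (X * S)]mulrA VmxT; last by lia.
  rewrite -[X in eqpm _ X]mulrA => E.
  case: (ltnP j (p - 1)) => h.
    exists e, false, (rcons w j.+1); split.
      by rewrite /gen_word all_rcons -/(gen_word p w) hw andbT; lia.
    rewrite expr0 mulr1 -cats1 gen_prod_cat gen_prod1 mulrA.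
    by rewrite /Vmx subSS subn0.
  exists e, true, w; split => //; rewrite expr1.
  suff F : U ^+ j * S = T by rewrite F in E.
  have -> : j = (p - 1)%N by lia.
  apply: (mulIr unitT); rewrite -mulrA -/U -exprSr subn1 prednK ?UmxXp ?TmxT //; lia.
- have E : eqpm (M * T) (T ^+ e * V w * T ^+ f * T) by apply: eqpmM => //; left.
  case: f E {hM} => E; last first.
    by exists e, true, w; split=> //; move: E; rewrite expr0 mulr1 expr1.
  exists e, false, w; split=> //; apply: eqpm_trans E _; right.
  by rewrite expr1 expr0 mulr1 -mulrA TmxT mulrN1.
Qed.

Definition pos_mx M := [/\ 0 < M 0 0, 0 < M 0 1, 0 < M 1 0 & 0 < M 1 1].

(** A factor T on one side or on both creates nonnegative as well as nonpositive entries, so in the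
    normal form only V_w itself can be positive. *)
Lemma pos_hecke_word M : hecke p M -> pos_mx M ->
  exists2 w, gen_word p w & M = V w.
Proof.
move=> /hecke_normal_form [e [f [w [hw hM]]]] [h1 h2 h3 h4].
have [ha hb hc hd] := gen_prod_ge R hp hw; exists w => //; move: h1 h2 h3 h4.
by case: e f hM => [] [] []; rewrite ?expr1 ?expr0 ?mul1r ?mulr1 => -> //;
  rewrite ?opp2E ?mul2E ?mx22E => *; exfalso; lra.
Qed.

(** The first column stands for a vector of the open positive quadrant, so that the action on
    vectors is a product of square matrices. *)
Definition pos_col M := 0 < M 0 0 /\ 0 < M 1 0.

Lemma pos_colM w A : gen_word p w -> pos_col A -> pos_col (V w * A).
Proof.
move=> /(gen_prod_ge R hp) [ha hb hc hd] [h1 h2].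
by rewrite /pos_col !mul2E; split; nra.
Qed.

(* The images of the positive quadrant under distinct V_j do not meet. *)
Lemma Vmx_quadrant_disjoint j k A B : (1 <= j < k)%N -> (k <= p - 1)%N ->
  pos_col A -> pos_col B -> Vmx R p j * A = Vmx R p k * B -> False.
Proof.
(* The factorization comes from V_j T = U^j. Cancelling V_j leaves A = T V_(k-j) B, whose upper left
   entry is negative. *)
move=> hjk hk hA hB; have -> : Vmx R p k = Vmx R p j * T * Vmx R p (k - j).
  rewrite VmxT; last by lia.
  by rewrite /Vmx mulrA -exprD; congr (U ^+ _ * _); lia.
have uV : Vmx R p j \is a GRing.unit.
  by rewrite -gen_prod1; apply/det1_unit/det_gen.
rewrite -(mulrA (_ * T)) -(mulrA (Vmx R p j)) => /(mulrI uV) E.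
have [] : pos_col (V [:: (k - j)%N] * B) by apply: pos_colM => //=; lia.
have [h1 h2] := hA; rewrite gen_prod1 => _.
by move: h1; rewrite E mul2E !mx22E; lra.
Qed.

Lemma Vmx_quadrant_inj j k A B : (1 <= j <= p - 1)%N -> (1 <= k <= p - 1)%N ->
  pos_col A -> pos_col B -> Vmx R p j * A = Vmx R p k * B -> j = k.
Proof.
move=> hj hk hA hB E; case: (ltngtP j k) => // h; exfalso.
  by apply: (Vmx_quadrant_disjoint _ _ hA hB E); lia.
by apply: (Vmx_quadrant_disjoint _ _ hB hA (esym E)); lia.
Qed.

(** Letters are read off one by one from the cone containing the common vector. Equal lengths make
    both words end together; otherwise [A] or [B] could absorb the rest of one of them. *)
Lemma gen_prod_quadrant w v A B : gen_word p w -> gen_word p v ->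
  size w = size v -> pos_col A -> pos_col B -> V w * A = V v * B -> w = v.
Proof.
elim: w v => [|j w IH] [|k v] //= /andP[hj hw] /andP[hk hv] [sz] hA hB.
rewrite !gen_prod_cons -(mulrA (Vmx R p j)) -(mulrA (Vmx R p k)) => E.
have ejk := Vmx_quadrant_inj hj hk (pos_colM hw hA) (pos_colM hv hB) E.
rewrite -ejk in E *; congr (_ :: _); apply: IH => //.
by apply: mulrI E; rewrite -gen_prod1; apply/det1_unit/det_gen.
Qed.

Lemma gen_prod_neq1 j w : gen_word p (j :: w) -> V (j :: w) <> 1.
Proof.
case: j => // j /= /andP[hj hw]; rewrite gen_prod_cons (VmxE R hp) => E.
have [ha hb hc hd] := gen_prod_ge R hp hw.
have s0 : 1 <= sn R p j.+1 by apply: (sn_ge1 R hp); lia.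
have := congr1 (fun M : 'M[R]_2 => M 0 1) E; rewrite mul2E !mx22E !one2E => E1.
have := congr1 (fun M : 'M[R]_2 => M 1 0) E; rewrite mul2E !mx22E !one2E => E2.
(* The off-diagonal entries of the first letter do not both vanish: the upper one is zero only for
   the letter p - 1, and then the lower one is positive because p >= 3. *)
clear E; case: (ltnP j.+2 p) => h.
  have s1 : 1 <= sn R p j.+2 by apply: (sn_ge1 R hp); lia.
  by nra.
have s1 : 1 <= sn R p j by apply: (sn_ge1 R hp); lia.
by nra.
Qed.

Lemma gen_prod_inj w v : gen_word p w -> gen_word p v -> V w = V v -> w = v.
Proof.
elim: w v => [|j w IH] [|k v] //=.
- by move=> _ h E; case: (gen_prod_neq1 h); rewrite -E gen_prod_nil.
- by move=> h _ E; case: (gen_prod_neq1 h); rewrite E gen_prod_nil.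
move=> /andP[hj hw] /andP[hk hv]; rewrite !gen_prod_cons => E.
(* The test vector (1, 1) of the quadrant identifies the first letter. *)
have h1 : pos_col (mx22 1 0 1 0 : 'M[R]_2) by rewrite /pos_col !mx22E ltr01.
have := congr1 (fun M => M * mx22 1 0 1 0) E; rewrite -(mulrA (Vmx R p j)) -(mulrA (Vmx R p k)).
move=> /(Vmx_quadrant_inj hj hk (pos_colM hw h1) (pos_colM hv h1)) ejk.
rewrite -ejk in E *; congr (_ :: _); apply: IH => //.
by apply: mulrI E; rewrite -gen_prod1; apply/det1_unit/det_gen.
Qed.

Lemma gen_prod_eqpm w v : gen_word p w -> gen_word p v -> eqpm (V w) (V v) ->
  w = v.
Proof.
move=> hw hv [|E]; first exact: gen_prod_inj.
have [h _ _ _] := gen_prod_ge R hp hw; have [h' _ _ _] := gen_prod_ge R hp hv.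
by exfalso; move: h; rewrite E opp2E; clear E; lra.
Qed.

(** Invariance of the symplectic form with matrix T. It cancels a V_u facing a T at the cost of its
    transpose, again a generator product. *)
Lemma trmx_T_mul M : \det M = 1 -> M^T * T * M = T.
Proof.
move=> h; rewrite -(Tmx_conjV h) mulrVK ?unitT // mulrVK //.
exact: det1_unit.
Qed.

Lemma mul_T_trmx M : \det M = 1 -> M * T * M^T = T.
Proof. by move=> h; rewrite -{1}(trmxK M); apply: trmx_T_mul; rewrite det_tr. Qed.

(** With g = +- T^e V_u T^f, multiplying by transposes removes every T and leaves an equation
    between words. For e = f it is a conjugacy equation; for e <> f the lengths disagree. *)
Lemma conj_gen_prod_rot w v g : w != [::] -> v != [::] ->
  gen_word p w -> gen_word p v -> hecke p g ->
  eqpm (V w * g) (g * V v) -> exists k, w = rot k v.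
Proof.
move=> w0 v0 hw hv /hecke_normal_form [e [f [u [hu hg]]]] E.
have {hg g E} E : eqpm (V w * (T ^+ e * V u * T ^+ f)) (T ^+ e * V u * T ^+ f * V v).
  apply: eqpm_trans (eqpmM (or_introl erefl) (eqpm_sym hg)) _.
  by apply: eqpm_trans E _; apply: eqpmM => //; left.
have dW := det_gen R p w; have dU := det_gen R p u; have dV := det_gen R p v.
have hu' := gen_word_tr hu; have hw' := gen_word_tr hw; have hv' := gen_word_tr hv.
case: e f E => [] []; rewrite ?expr1 ?expr0 ?mul1r ?mulr1 => E.
(* Leads to [v ++ word_tr p u = word_tr p u ++ w], hence to [v] as a rotation of [w], which is then
   inverted. *)
- have {E} := eqpmMlr (V u)^T (V u)^T E.
  have -> : (V u)^T * (V w * (T * V u * T)) * (V u)^T =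
            (V u)^T * V w * (T * (V u * T * (V u)^T)) by rewrite !mulrA.
  have -> : (V u)^T * (T * V u * T * V v) * (V u)^T =
            ((V u)^T * T * V u) * T * V v * (V u)^T by rewrite !mulrA.
  rewrite mul_T_trmx // trmx_T_mul // TmxT mulrN1 mulN1r mulNr.
  move=> /eqpmNl /eqpm_sym /eqpmNl.
  rewrite -gen_prod_tr // -!gen_prod_cat => /gen_prod_eqpm.
  rewrite !gen_word_cat hu' hw hv => /(_ isT isT) /conj_word_rot [k ->].
  by exists (size (rot k w) - k)%N; rewrite -/(rotr k (rot k w)) rotK.
(* Leads to [word_tr p w ++ u ++ v = u], absurd as [v] is non-empty; the next case is symmetric. *)
- have {E} := eqpmMlr ((V w)^T * T) 1 E; rewrite !mulr1.
  have -> : (V w)^T * T * (V w * (T * V u)) = ((V w)^T * T * V w) * T * V u.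
    by rewrite !mulrA.
  have -> : (V w)^T * T * (T * V u * V v) = (V w)^T * (T * T) * V u * V v.
    by rewrite !mulrA.
  rewrite trmx_T_mul // TmxT mulrN1 mulN1r !mulNr => /eqpmNl /eqpm_sym /eqpmNl.
  rewrite -gen_prod_tr // -!gen_prod_cat => /gen_prod_eqpm.
  rewrite !gen_word_cat hw' hu hv => /(_ isT isT) /(congr1 size).
  by case: (v) v0 => // j v' _; rewrite !size_cat /=; lia.
- have {E} := eqpmMlr 1 (T * (V v)^T) E; rewrite !mul1r.
  have -> : V w * (V u * T) * (T * (V v)^T) = V w * V u * (T * T) * (V v)^T.
    by rewrite !mulrA.
  have -> : V u * T * V v * (T * (V v)^T) = V u * (T * (V v * T * (V v)^T)).
    by rewrite !mulrA.
  rewrite mul_T_trmx // TmxT !mulrN1 mulNr => /eqpmNl /eqpm_sym /eqpmNl.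
  rewrite -gen_prod_tr // -!gen_prod_cat => /gen_prod_eqpm.
  rewrite !gen_word_cat hw hu hv' => /(_ isT isT) /(congr1 size).
  by case: (w) w0 => // j w' _; rewrite !size_cat /=; lia.
- move: E; rewrite -!gen_prod_cat => /gen_prod_eqpm.
  by rewrite !gen_word_cat hw hu hv => /(_ isT isT) /conj_word_rot.
Qed.

End NormalForm.

(** * Fixed points as eigenvectors; positivity and attraction *)

Section EigenPoints.
Variable R : realType.
Implicit Types (M N : 'M[R]_2) (x y z a b c : R).

(* M (x, 1)^T = a (x, 1)^T: x is a finite fixed point of the Moebius map of M. *)
Definition eig M x a : Prop :=
  M 0 0 * x + M 0 1 = a * x /\ M 1 0 * x + M 1 1 = a.

Lemma eig_col M x a : eig M x a -> M * mx22 x 0 1 0 = a *: mx22 x 0 1 0.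
Proof.
move=> [h1 h2]; apply: mx2P; rewrite mul2E [RHS]mxE !mx22E ?mulr1 ?mulr0 ?addr0 //.
Qed.

Lemma eig1 x : eig 1 x 1.
Proof. by rewrite /eig !one2E; split; ring. Qed.

Lemma eigM M N x a b : eig M x a -> eig N x b -> eig (M * N) x (a * b).
Proof.
move=> [h1 h2] [h3 h4]; rewrite /eig !mul2E; split.
  transitivity (M 0 0 * (N 0 0 * x + N 0 1) + M 0 1 * (N 1 0 * x + N 1 1)); first by ring.
  by rewrite h3 h4 -mulrA [a * _]mulrCA -h1; ring.
transitivity (M 1 0 * (N 0 0 * x + N 0 1) + M 1 1 * (N 1 0 * x + N 1 1)); first by ring.
by rewrite h3 h4 -h2; ring.
Qed.

Lemma eigX M x a n : eig M x a -> eig (M ^+ n) x (a ^+ n).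
Proof.
move=> h; elim: n => [|n IH]; first by rewrite !expr0; apply: eig1.
by rewrite !exprS; apply: eigM.
Qed.

Lemma eigN M x a : eig M x a -> eig (- M) x (- a).
Proof.
move=> [h1 h2]; rewrite /eig !opp2E; split; last by rewrite -h2; ring.
by rewrite [RHS]mulNr -h1; ring.
Qed.

Lemma eig_neq0 M x a : \det M = 1 -> eig M x a -> a != 0.
Proof.
rewrite det2E => hd [h1 h2]; apply/eqP => a0; move: h1 h2; rewrite a0 mul0r => h1 h2.
suff : 1 = 0 :> R by apply/eqP/oner_neq0.
rewrite -hd; have -> : M 0 1 = - (M 0 0 * x) by apply/eqP; rewrite -addr_eq0 addrC h1.
by have -> : M 1 1 = - (M 1 0 * x) by [apply/eqP; rewrite -addr_eq0 addrC h2]; ring.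
Qed.

Lemma eigV M x a : \det M = 1 -> eig M x a -> eig M^-1 x a^-1.
Proof.
move=> hd h; have a0 := eig_neq0 hd h; move: h => [h1 h2].
rewrite /eig inv2E // !mx22E; move: hd; rewrite det2E => hd.
have E : a * (- M 1 0 * x + M 0 0) = 1.
  rewrite -hd -{1}h2.
  transitivity (M 0 0 * (M 1 0 * x + M 1 1) - M 1 0 * ((M 1 0 * x + M 1 1) * x)); first by ring.
  by rewrite h2 -h1 -h2; ring.
have F : - M 1 0 * x + M 0 0 = a^-1 by apply: (mulfI a0); rewrite E divff.
split=> //; apply: (mulfI a0); rewrite mulrA divff // mul1r.
transitivity (M 1 1 * (a * x) - M 0 1 * a); first by ring.
by rewrite -h1 -{1}h2 -[RHS]mul1r -hd; ring.
Qed.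

Lemma fixed_ptP M x : fixed_pt M x <-> exists2 a, a != 0 & eig M x a.
Proof.
rewrite /fixed_pt /moebius; split=> [[h0 h]|[a a0 [h1 h2]]].
  exists (M 1 0 * x + M 1 1) => //; split=> //.
  by have := congr1 ( *%R (M 1 0 * x + M 1 1)) h; rewrite mulrC divfK.
by rewrite h2 a0 h1 mulrAC divff // mul1r.
Qed.

Section TwoEigenpoints.
Variables (M : 'M[R]_2) (x y a b : R).
Hypotheses (xy : x != y) (Hx : eig M x a) (Hy : eig M y b).

(** The entries of P diag(a, b) P^-1, where P has columns (x, 1) and (y, 1). *)
Lemma eig_pairE :
  [/\ M 0 0 = (a * x - b * y) / (x - y), M 0 1 = - (x * y * (a - b)) / (x - y),
      M 1 0 = (a - b) / (x - y) & M 1 1 = (b * x - a * y) / (x - y)].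
Proof.
have d0 : x - y != 0 by rewrite subr_eq0.
case: Hx Hy => [h1 h2] [h3 h4].
have E A B : A * (x - y) = B -> A = B / (x - y) by move=> <-; rewrite mulfK.
split; apply: E.
- by rewrite -h1 -h3; ring.
- transitivity (x * (M 0 0 * y + M 0 1) - y * (M 0 0 * x + M 0 1)); first by ring.
  by rewrite h1 h3; ring.
- by rewrite -h2 -h4; ring.
- by rewrite -h2 -h4; ring.
Qed.

Lemma eig_det : \det M = a * b.
Proof.
have d0 : x - y != 0 by rewrite subr_eq0.
by rewrite det2E; have [-> -> -> ->] := eig_pairE; field.
Qed.

Lemma eig_tr : \tr M = a + b.
Proof.
have d0 : x - y != 0 by rewrite subr_eq0.
by rewrite tr2E; have [-> _ _ ->] := eig_pairE; field.
Qed.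

Lemma eig_10_neq0 : a != b -> M 1 0 != 0.
Proof.
have [_ _ -> _] := eig_pairE => ab.
by rewrite mulf_neq0 ?invr_eq0 ?subr_eq0.
Qed.

(** The fixed-point equation is quadratic, with leading coefficient [M 1 0] non-zero and roots [x]
    and [y]. *)
Lemma eig_third z c : a != b -> eig M z c -> z = x \/ z = y.
Proof.
have d0 : x - y != 0 by rewrite subr_eq0.
move=> ab [h1 h2]; have m0 := eig_10_neq0 ab.
have : M 1 0 * ((z - x) * (z - y)) = 0.
  transitivity ((M 1 0 * z + M 1 1) * z - (M 0 0 * z + M 0 1)).
    by have [-> -> -> ->] := eig_pairE; field.
  by rewrite h1 h2 subrr.
move/eqP; rewrite !mulf_eq0 (negPf m0) /= !subr_eq0 => /orP[]/eqP ->; by [left|right].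
Qed.

(** [N] preserves the eigenlines of [M], the eigenvalues being distinct. The computation compares
    second rows and cancels [M 1 0]. *)
Lemma eig_commute N : a != b -> M * N = N * M -> exists c, eig N y c.
Proof.
move=> ab E; have m0 := eig_10_neq0 ab; exists (N 1 0 * y + N 1 1); split=> //.
have [h1 h2] := Hy; apply: (mulfI m0).
have E0 := congr1 (fun K : 'M[R]_2 => K 1 0) E; have E1 := congr1 (fun K : 'M[R]_2 => K 1 1) E.
rewrite !mul2E in E0 E1.
have : (M 1 0 * N 0 0 + M 1 1 * N 1 0) * y + (M 1 0 * N 0 1 + M 1 1 * N 1 1)
   = N 1 0 * (M 0 0 * y + M 0 1) + N 1 1 * (M 1 0 * y + M 1 1).
  by rewrite E0 E1; ring.
rewrite h1 -h2 => F.
transitivity ((M 1 0 * N 0 0 + M 1 1 * N 1 0) * y + (M 1 0 * N 0 1 + M 1 1 * N 1 1)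
  - M 1 1 * (N 1 0 * y + N 1 1)); first by ring.
by rewrite F; ring.
Qed.

End TwoEigenpoints.

Lemma eig_pos M x y a : y < 0 < x -> 1 < a -> eig M x a -> eig M y a^-1 ->
  pos_mx M.
Proof.
move=> /andP[y0 x0] a1 hx hy.
have xy : x != y by apply/eqP => E; move: x0; rewrite E; lra.
have b0 : 0 < a^-1 by rewrite invr_gt0; lra.
have b1 : a^-1 < 1 by rewrite invf_lt1; lra.
rewrite /pos_mx; have [-> -> -> ->] := eig_pairE xy hx hy.
move: (a^-1) b0 b1 => b b0 b1.
have p1 : 0 < x * - y by rewrite mulr_gt0 //; lra.
have p2 : 0 < a - b by lra.
have p3 : 0 < x * - y * (a - b) by rewrite mulr_gt0.
have p4 : 0 < b * x by rewrite mulr_gt0.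
have p5 : 0 < a * x by rewrite mulr_gt0 //; lra.
have p6 : 0 < b * - y by rewrite mulr_gt0 //; lra.
have p7 : 0 < a * - y by rewrite mulr_gt0 //; lra.
by split; apply: divr_gt0; lra.
Qed.

(** Bernoulli's inequality and the Archimedean property. *)
Lemma geometric_unbounded a (K : R) : 1 < a -> exists n, K < a ^+ n.
Proof.
move=> a1; have B n : 1 + n%:R * (a - 1) <= a ^+ n.
  elim: n => [|n IH]; first by rewrite mul0r addr0 expr0.
  rewrite exprS -natr1; have n0 : 0 <= n%:R :> R by [].
  have n2 : 0 <= n%:R * (a - 1) ^+ 2 by rewrite mulr_ge0 // sqr_ge0.
  apply: (@le_trans _ _ (a * (1 + n%:R * (a - 1)))); last by rewrite ler_pM2l //; lra.
  by move: (n%:R : R) n2 => t; lra.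
exists (Num.bound (K / (a - 1))); apply: lt_le_trans (B _).
have a0 : 0 < a - 1 by lra.
have : K / (a - 1) < (Num.bound (K / (a - 1)))%:R by exact: unstable.ltr_bound.
by rewrite ltr_pdivrMr //; lra.
Qed.

(** M^n is dominated by a^n times the projection onto (x, 1) along (y, 1), whose entries are
    positive, and N multiplies (x, 1) by c > 0. *)
Lemma pos_mx_mul_pow N M x y a c : y < 0 < x -> 1 < a -> 0 < c ->
  eig M x a -> eig M y a^-1 -> eig N x c -> exists n, pos_mx (N * M ^+ n).
Proof.
move=> yx a1 c0 hx hy [hN1 hN2]; have /andP[y0 x0] := yx.
have xy : x != y by apply/eqP => E; move: x0; rewrite E; lra.
have d0 : 0 < x - y by lra.
have d0' : x - y != 0 by rewrite gt_eqF.
set q0 := N 0 0 * y + N 0 1; set q1 := N 1 0 * y + N 1 1.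
(* Each entry of the product is [(a ^+ n * u + a^-1 ^+ n * q) / (x - y)] with [u > 0], positive once
   [a ^+ n] exceeds [k u q]. The sum [K] below bounds all four ratios. *)
pose k (u q : R) : R := `|q| / u.
have k_ge0 u q : 0 < u -> 0 <= k u q by move=> u0; rewrite divr_ge0 // ltW.
have u1 : 0 < c * x by rewrite mulr_gt0.
have u2 : 0 < - y * (c * x) by rewrite mulr_gt0 //; lra.
have u3 : 0 < - y * c by rewrite mulr_gt0 //; lra.
pose K := k (c * x) (- q0) + k (- y * (c * x)) (x * q0) + k c (- q1) + k (- y * c) (x * q1).
have [n hn] := geometric_unbounded K a1; exists n.
have an1 : 1 <= a ^+ n by rewrite exprn_ege1 // ltW.
have an0 : 0 < a ^+ n by lra.
have E u q : 0 < u -> k u q <= K -> 0 < a ^+ n * u + a^-1 ^+ n * q.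
  move=> u0 hk; have : `|q| < a ^+ n * u by rewrite -ltr_pdivrMr //; apply: le_lt_trans hn.
  have b0 : 0 <= a^-1 ^+ n by rewrite exprn_ge0 // invr_ge0; lra.
  have b1 : a^-1 ^+ n <= 1 by rewrite exprVn invf_le1.
  have := ler_norm (- q); rewrite normrN; have := normr_ge0 q; nra.
have k1 := k_ge0 _ (- q0) u1; have k2 := k_ge0 _ (x * q0) u2.
have k3 := k_ge0 _ (- q1) c0; have k4 := k_ge0 _ (x * q1) u3.
have [e1 e2 e3 e4] := eig_pairE xy (eigX n hx) (eigX n hy).
rewrite /pos_mx !mul2E e1 e2 e3 e4; split.
- have -> : N 0 0 * ((a ^+ n * x - a^-1 ^+ n * y) / (x - y)) +
      N 0 1 * ((a ^+ n - a^-1 ^+ n) / (x - y)) =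
      (a ^+ n * (c * x) + a^-1 ^+ n * (- q0)) / (x - y).
    by rewrite -hN1 /q0; field.
  by apply: divr_gt0 => //; apply: E => //; rewrite /K; lra.
- have -> : N 0 0 * (- (x * y * (a ^+ n - a^-1 ^+ n)) / (x - y)) +
      N 0 1 * ((a^-1 ^+ n * x - a ^+ n * y) / (x - y)) =
      (a ^+ n * (- y * (c * x)) + a^-1 ^+ n * (x * q0)) / (x - y).
    by rewrite -hN1 /q0; field.
  by apply: divr_gt0 => //; apply: E => //; rewrite /K; lra.
- have -> : N 1 0 * ((a ^+ n * x - a^-1 ^+ n * y) / (x - y)) +
      N 1 1 * ((a ^+ n - a^-1 ^+ n) / (x - y)) =
      (a ^+ n * c + a^-1 ^+ n * (- q1)) / (x - y).
    by rewrite -hN2 /q1; field.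
  by apply: divr_gt0 => //; apply: E => //; rewrite /K; lra.
- have -> : N 1 0 * (- (x * y * (a ^+ n - a^-1 ^+ n)) / (x - y)) +
      N 1 1 * ((a^-1 ^+ n * x - a ^+ n * y) / (x - y)) =
      (a ^+ n * (- y * c) + a^-1 ^+ n * (x * q1)) / (x - y).
    by rewrite -hN2 /q1; field.
  by apply: divr_gt0 => //; apply: E => //; rewrite /K; lra.
Qed.

Lemma derive_moebius M x : \det M = 1 -> M 1 0 * x + M 1 1 != 0 ->
  derive1 (moebius M) x = (M 1 0 * x + M 1 1) ^- 2.
Proof.
move=> hd h0; rewrite derive1E.
have D (u v : R) : is_derive x 1 (fun t : R => u * t + v) u.
  have -> : (fun t : R => u * t + v) = (cst u * id + cst v : R -> R) by [].
  by apply: is_derive_eq; rewrite /GRing.scale /= addr0 mulr0 addr0 mulr1.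
have Dm : is_derive x 1 (moebius M) ((M 1 0 * x + M 1 1) ^- 2).
  have Di := is_deriveV (f := fun t : R => M 1 0 * t + M 1 1) h0 (D (M 1 0) (M 1 1)).
  have := is_deriveM (D (M 0 0) (M 0 1)) Di.
  have -> : (fun t : R => M 0 0 * t + M 0 1) * (fun t => (M 1 0 * t + M 1 1)^-1) = moebius M by [].
  move=> H; apply: is_derive_eq H _; rewrite /GRing.scale /=.
  move: hd; rewrite det2E => hd.
  transitivity ((M 0 0 * M 1 1 - M 0 1 * M 1 0) / (M 1 0 * x + M 1 1) ^+ 2); first by field.
  by rewrite hd mul1r.
exact: derive_val.
Qed.

(** The denominator at a fixed point is its eigenvalue [a], so the derivative there is [a ^- 2]. *)
Lemma attractingP M x : \det M = 1 ->
  attracting M x <-> exists2 a, 1 < `|a| & eig M x a.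
Proof.
move=> hd; rewrite /attracting; split=> [[hf]|[a a1 ha]].
  have [a a0 ha] := (fixed_ptP _ _).1 hf; have [_ h2] := ha.
  rewrite derive_moebius // h2 // normrV ?unitfE ?expf_neq0 // normrX.
  rewrite invf_lt1 ?exprn_gt0 ?normr_gt0 // => h; exists a => //.
  by rewrite -(expr_gt1 (n := 2)).
have a0 : a != 0 by rewrite -normr_gt0; apply: lt_trans a1.
split; first by apply/fixed_ptP; exists a.
have [_ h2] := ha; rewrite derive_moebius // h2 // normrV ?unitfE ?expf_neq0 // normrX.
by rewrite invf_lt1 ?exprn_gt0 ?normr_gt0 // expr_gt1.
Qed.

End EigenPoints.

(** * Uniqueness of the Hecke-conjugate and of the primitive element *)

Section HeckeConjugate.
Variables (R : realType) (p : nat).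
Hypothesis hp : (3 <= p)%N.
Implicit Types (M N g W : 'M[R]_2) (w u v : seq nat) (x y z a b c : R).

Local Notation T := (Tmx R).
Local Notation V := (gen_prod R p).

Lemma sgn_neq x y : y < 0 < x -> x != y.
Proof. by move=> /andP[h1 h2]; apply/eqP => E; move: h2; rewrite E; lra. Qed.

Lemma gt1_neq_inv a : 1 < a -> a != a^-1.
Proof.
move=> a1; have : a^-1 < 1 by rewrite invf_lt1; lra.
by move=> b1; apply/eqP => E; move: b1; rewrite -E; lra.
Qed.

Lemma gt1_inv_add a : 1 < a -> 2 < a + a^-1.
Proof.
move=> a1; rewrite -subr_gt0.
have -> : a + a^-1 - 2 = (a - 1) ^+ 2 / a by field; rewrite gt_eqF //; lra.
by rewrite divr_gt0 ?exprn_gt0; lra.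
Qed.

Lemma eig_gen_word M x y a : hecke p M -> y < 0 < x -> 1 < a ->
  eig M x a -> eig M y a^-1 -> exists2 w, gen_word p w & M = V w.
Proof. by move=> hM yx a1 hx hy; apply: pos_hecke_word => //; apply: eig_pos hx hy. Qed.

(** One of M, -M, M^-1, -M^-1 has eigenvalue greater than 1 at [x]; the eigenvalues 1 and -1 would
    give trace 2 or -2. *)
Lemma hyperbolic_gen_word M x y a b : hecke p M -> hyperbolic M -> y < 0 < x ->
  eig M x a -> eig M y b ->
  exists w c, [/\ gen_word p w, 1 < c, eig (V w) x c & eig (V w) y c^-1].
Proof.
move=> hM hyp yx hx hy; have xy := sgn_neq yx.
have H N c : hecke p N -> 1 < c -> eig N x c -> eig N y c^-1 ->
    exists w c, [/\ gen_word p w, 1 < c, eig (V w) x c & eig (V w) y c^-1].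
  move=> hN c1 h1 h2; have [w hw E] := eig_gen_word hN yx c1 h1 h2.
  by exists w, c; rewrite -E.
have hd := hecke_det hM; have a0 := eig_neq0 hd hx.
have Eb : b = a^-1.
  by apply: (mulfI a0); rewrite divff // -hd (eig_det xy hx hy).
rewrite Eb in hy; move: hyp; rewrite /hyperbolic (eig_tr xy hx hy) => hyp.
have hx' := eigV hd hx; have hy' := eigV hd hy.
case: (ltrgtP a 0) a0 => // s _.
- case: (ltrgtP a (-1)) => h.
  + apply: (H _ (- a) (heckeN hM)); first lra.
      exact: eigN.
    by rewrite invrN; apply: eigN.
  + apply: (H _ (- a^-1) (heckeN (heckeV hM))).
    * by rewrite -invrN invf_gt1; lra.
    * exact: eigN.
    * by rewrite invrN; apply: eigN.
  + by move: hyp; rewrite h invrN1 -opprD normrN ger0_norm ?ltxx.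
- case: (ltrgtP a 1) => h.
  + apply: (H _ a^-1 (heckeV hM)) => //.
    by rewrite invf_gt1.
  + exact: (H M a hM h hx hy).
  + by move: hyp; rewrite h invr1 ger0_norm ?ltxx //.
Qed.

(** Both concatenations have the same length and multiply the vector (x, 1) by the same scalar. *)
Lemma eig_words_comm w v x a b : gen_word p w -> gen_word p v -> 0 < x ->
  eig (V w) x a -> eig (V v) x b -> w ++ v = v ++ w.
Proof.
move=> hw hv x0 /eig_col ha /eig_col hb.
have hc : pos_col (mx22 x 0 1 0) by rewrite /pos_col !mx22E.
apply: (gen_prod_quadrant hp _ _ _ hc hc); rewrite ?gen_word_cat ?hw ?hv //.
  by rewrite !size_cat addnC.
rewrite !gen_prod_cat -!mulrA ha hb -!scalerAr ha hb !scalerA.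
by rewrite mulrC.
Qed.

(* N V_w^n is a positive matrix for large n, hence again a generator product;  *)
(* as it fixes x as well, its word commutes with w.                            *)
Lemma stabilizer_fixes_conj w N x y a c : gen_word p w -> y < 0 < x -> 1 < a ->
  eig (V w) x a -> eig (V w) y a^-1 -> hecke p N -> eig N x c ->
  exists d, eig N y d.
Proof.
move=> hw yx a1 hx hy.
wlog c0 : N c / 0 < c => [H hN hc|hN hc].
  case: (ltrgtP c 0) (eig_neq0 (hecke_det hN) hc) => // s _; last exact: (H N c).
  have [|d hd] := H (- N) (- c) _ (heckeN hN) (eigN hc); first by rewrite oppr_gt0.
  by exists (- d); rewrite -(opprK N); apply: eigN.
have [n hn] := pos_mx_mul_pow yx a1 c0 hx hy hc.
have hXn := heckeX n (hecke_gen R p w).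
have [v hv E] := pos_hecke_word hp (heckeM hN hXn) hn.
have x0 : 0 < x by case/andP: yx.
have hvx : eig (V v) x (c * a ^+ n) by rewrite -E; apply: eigM => //; apply: eigX.
have /(congr1 (gen_prod R p)) := eig_words_comm hw hv x0 hx hvx.
rewrite !gen_prod_cat => /(eig_commute (sgn_neq yx) hx hy (gt1_neq_inv a1)) [d hd].
(* V_v = N V_w^n has eigenvalue [d] at [y], since it commutes with V_w; dividing by V_w^n gives the
   eigenvalue of N. *)
exists (d * (a^-1 ^+ n)^-1).
have -> : N = V v * (V w ^+ n)^-1.
  by rewrite -E mulrK // det1_unit // (hecke_det hXn).
by apply: eigM => //; apply: eigV; [exact: hecke_det hXn|exact: eigX].
Qed.

Lemma Hconj_eig x y : Hconj p x y <-> exists M a b,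
  [/\ hecke p M, hyperbolic M, eig M x a, eig M y b & y != x].
Proof.
split=> [[M [hM hyp /fixed_ptP [a _ ha] /fixed_ptP [b _ hb] yx]]|].
  by exists M, a, b.
move=> [M [a [b [hM hyp ha hb yx]]]]; exists M.
have hd := hecke_det hM.
by split=> //; apply/fixed_ptP; [exists a|exists b] => //; apply: eig_neq0; eassumption.
Qed.

Lemma Hconj_stabilizer x y N c : y < 0 < x -> Hconj p x y -> hecke p N ->
  eig N x c -> exists d, eig N y d.
Proof.
move=> yx /Hconj_eig [M [a [b [hM hyp ha hb _]]]].
have [w [e [hw e1 h1 h2]]] := hyperbolic_gen_word hM hyp yx ha hb.
exact: (stabilizer_fixes_conj hw yx e1 h1 h2).
Qed.

Lemma hyperbolic_eig_neq M x y a b : hecke p M -> hyperbolic M -> x != y ->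
  eig M x a -> eig M y b -> a != b.
Proof.
move=> hM hyp xy ha hb; apply/eqP => E; move: hyp.
rewrite /hyperbolic (eig_tr xy ha hb) -E.
have : a ^+ 2 = 1 by rewrite -(hecke_det hM) (eig_det xy ha hb) -E expr2.
move/eqP; rewrite sqrf_eq1 => /orP[]/eqP ->; first by rewrite ger0_norm ?ltxx.
by rewrite -opprD normrN ger0_norm ?ltxx.
Qed.

(** An element that fixes [x] and [z] also fixes [y], but it has only two fixed points. *)
Lemma Hconj_unique x y z : y < 0 < x -> Hconj p x y -> Hconj p x z -> z = y.
Proof.
move=> yx hy /Hconj_eig [N [a [b [hN hyp ha hb zx]]]].
have [d hd] := Hconj_stabilizer yx hy hN ha.
rewrite eq_sym in zx; have ab := hyperbolic_eig_neq hN hyp zx ha hb.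
case: (eig_third zx ha hb ab hd) => [E|//].
by have := sgn_neq yx; rewrite E eqxx.
Qed.

Lemma moebiusT x : moebius T x = - x^-1.
Proof. by rewrite /moebius !mx22E mul0r add0r mul1r addr0 mulN1r. Qed.

Lemma eig_T M x a : x != 0 -> eig M x a -> eig (T * M * T^-1) (- x^-1) a.
Proof.
move=> x0 [h1 h2]; rewrite /eig invTmx !mul2E !opp2E !mx22E; split.
  apply: (mulfI x0); transitivity (- (M 1 0 * x + M 1 1)); first by field.
  by rewrite h2; field.
by apply: (mulfI x0); rewrite [RHS]mulrC -h1; field.
Qed.

Lemma hecke_Tconj M : hecke p M -> hecke p (T * M * T^-1).
Proof. by move=> h; do !apply: heckeM => //; [exact: heckeT|apply/heckeV/heckeT]. Qed.

Lemma hyperbolic_Tconj M : hyperbolic M -> hyperbolic (T * M * T^-1).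
Proof. by rewrite /hyperbolic tr_conj // det_Tmx. Qed.

Lemma Tconj_invol M : T * (T * M * T^-1) * T^-1 = M.
Proof.
by rewrite !invTmx !mulrA TmxT !mulN1r !mulrN mulNr -mulrA mulNr opprK TmxT mulrN1 opprK.
Qed.

Lemma Hconj_T x y : x != 0 -> y != 0 -> Hconj p x y ->
  Hconj p (- x^-1) (- y^-1).
Proof.
move=> x0 y0 /Hconj_eig [M [a [b [hM hyp ha hb yx]]]]; apply/Hconj_eig.
exists (T * M * T^-1), a, b; split; [exact: hecke_Tconj|exact: hyperbolic_Tconj| | |].
- exact: eig_T.
- exact: eig_T.
- by rewrite eqr_opp; apply: contra yx => /eqP/invr_inj ->.
Qed.

(** Here the base point is negative; conjugation by T brings the stabilizer argument back to the
    simple number [x]. *)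
Lemma Hconj_unique_T x y z : y < 0 < x -> Hconj p x y -> Hconj p (- x^-1) z ->
  z = - y^-1.
Proof.
move=> yx hy /Hconj_eig [N [a [b [hN hyp ha hb zx]]]].
have /andP[y0 x0] := yx.
have x0' : x != 0 by rewrite gt_eqF.
have y0' : y != 0 by rewrite lt_eqF.
have hx' : eig (T * N * T^-1) x a.
  have -> : x = - (- x^-1)^-1 by rewrite invrN opprK invrK.
  by apply: eig_T; rewrite // oppr_eq0 invr_eq0.
have [d /(eig_T y0')] := Hconj_stabilizer yx hy (hecke_Tconj hN) hx'.
rewrite Tconj_invol => hd.
rewrite eq_sym in zx; have ab := hyperbolic_eig_neq hN hyp zx ha hb.
case: (eig_third zx ha hb ab hd) => [/oppr_inj/invr_inj E|//].
by have := sgn_neq yx; rewrite E eqxx.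
Qed.

(** Both are generator products with commuting words, hence powers of one V_u. Exponent 0 would give
    eigenvalue 1, and primitivity excludes exponents above 1. *)
Lemma primitive_eig_unique M N x y z a b : hecke p M -> hecke p N ->
  primitive p M -> primitive p N -> 1 < a -> 1 < b -> y < 0 < x -> z < 0 < x ->
  eig M x a -> eig M y a^-1 -> eig N x b -> eig N z b^-1 -> M = N.
Proof.
move=> hM hN pM pN a1 b1 yx zx hx hy hx' hz.
have [w hw EM] := eig_gen_word hM yx a1 hx hy.
have [v hv EN] := eig_gen_word hN zx b1 hx' hz.
have x0 : 0 < x by case/andP: yx.
rewrite EM in hx; rewrite EN in hx'.
have [u [m [n [Ew Ev]]]] := cat_comm_pow (eig_words_comm hw hv x0 hx hx').
have one k W c : 1 < c -> eig W x c -> primitive p W -> W = V u ^+ k -> W = V u.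
  case: k => [|[|k]] c1 hc pW EW; rewrite EW ?expr1 //.
    by move: hc c1; rewrite EW expr0 => -[_]; rewrite !one2E mul0r add0r => <-; rewrite ltxx.
  by case: (pW k.+2 (V u) isT (hecke_gen R p u)); left.
rewrite Ew gen_prod_pow in EM; rewrite Ev gen_prod_pow in EN.
rewrite Ew gen_prod_pow -EM in hx; rewrite Ev gen_prod_pow -EN in hx'.
by rewrite (one _ _ _ a1 hx pM EM) (one _ _ _ b1 hx' pN EN).
Qed.

End HeckeConjugate.

(** * Equivalence of forms as conjugacy of matrices *)

Section Forms.
Variables (R : realType) (p : nat).
Implicit Types (M N g h W : 'M[R]_2) (Q : bqf R) (x y : R).

Lemma bqf_actM Q g h : bqf_act (bqf_act Q g) h = bqf_act Q (g * h).
Proof. by case: Q => A B C /=; rewrite !mul2E; congr Bqf; ring. Qed.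

Lemma bqf_act_Qmx N g : \det g = 1 -> bqf_act (Qmx N) g = Qmx (g^-1 * N * g).
Proof.
move=> hg; rewrite /Qmx /= (inv2E hg) !mul2E !mx22E.
by congr Bqf; ring.
Qed.

(* The trace is recovered up to sign from the discriminant tr^2 - 4. *)
Lemma Qmx_inj M N : \det M = 1 -> \det N = 1 -> 0 < \tr M -> 0 < \tr N ->
  Qmx M = Qmx N -> M = N.
Proof.
move=> dM dN tM tN [e10 e11 /oppr_inj e01].
have E (K : 'M[R]_2) : \det K = 1 -> (\tr K) ^+ 2 = (K 1 1 - K 0 0) ^+ 2 + 4 * K 0 1 * K 1 0 + 4.
  rewrite det2E tr2E => dK; transitivity ((K 1 1 - K 0 0) ^+ 2 + 4 * K 0 1 * K 1 0 +
    4 * (K 0 0 * K 1 1 - K 0 1 * K 1 0)); first by ring.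
  by rewrite dK mulr1.
have : \tr M = \tr N.
  apply/eqP; rewrite -(eqrXn2 (n := 2)) ?(ltW tM) ?(ltW tN) //.
  by rewrite E // E // e10 e11 e01.
rewrite !tr2E => et; apply: mx2P => //; lra.
Qed.

Lemma ZlamD x y : Zlam p x -> Zlam p y -> Zlam p (x + y).
Proof. by move=> [q ->] [r ->]; exists (q + r); rewrite rmorphD hornerD. Qed.

Lemma ZlamM x y : Zlam p x -> Zlam p y -> Zlam p (x * y).
Proof. by move=> [q ->] [r ->]; exists (q * r); rewrite rmorphM hornerM. Qed.

Lemma ZlamN x : Zlam p x -> Zlam p (- x).
Proof. by move=> [q ->]; exists (- q); rewrite rmorphN hornerN. Qed.

Lemma Zlam0 : Zlam p (0 : R).
Proof. by exists 0; rewrite rmorph0 horner0. Qed.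

Lemma Zlam1 : Zlam p (1 : R).
Proof. by exists 1; rewrite rmorph1 hornerC. Qed.

Lemma Zlam_lam : Zlam p (lam R p).
Proof. by exists 'X; rewrite map_polyX hornerX. Qed.

Lemma hecke_Zlam M : hecke p M ->
  [/\ Zlam p (M 0 0), Zlam p (M 0 1), Zlam p (M 1 0) & Zlam p (M 1 1)].
Proof.
have z0 := Zlam0; have z1 := Zlam1; have zl := Zlam_lam; have zN := ZlamN z1.
elim=> {M} [|||M N _ [? ? ? ?] _ [? ? ? ?]|M hM [? ? ? ?]].
- by rewrite !one2E.
- by rewrite !mx22E.
- by rewrite !mx22E.
- by rewrite !mul2E; split; apply: ZlamD; apply: ZlamM.
- by rewrite (inv2E (hecke_det hM)) !mx22E; split=> //; apply: ZlamN.
Qed.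

Lemma hecke_lam_bqf M : hecke p M -> lam_bqf p (Qmx M).
Proof.
move=> /hecke_Zlam [h1 h2 h3 h4]; split=> //=; last exact: ZlamN.
by apply: ZlamD => //; apply: ZlamN.
Qed.

(** Conjugacy without sign ambiguity. Between matrices of positive trace it agrees with
    [hecke_conj], since a sign would flip the trace. *)
Definition mconj W M : Prop := exists2 g, hecke p g & M = g * W * g^-1.

Lemma hecke_unit g : hecke p g -> g \is a GRing.unit.
Proof. by move/hecke_det/det1_unit. Qed.

Lemma mconj_sym W M : mconj W M -> mconj M W.
Proof.
move=> [g hg ->]; have ug := hecke_unit hg; exists g^-1; first exact: heckeV.
by rewrite invrK !mulrA mulVr // mul1r mulrVK.
Qed.

Lemma mconj_trans W M N : mconj W M -> mconj M N -> mconj W N.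
Proof.
move=> [g hg ->] [h hh ->]; have ug := hecke_unit hg; have uh := hecke_unit hh.
by exists (h * g); [exact: heckeM|rewrite invrM // !mulrA].
Qed.

Lemma mconj_hecke W M : hecke p W -> mconj W M -> hecke p M.
Proof. by move=> hW [g hg ->]; do !apply: heckeM => //; apply: heckeV. Qed.

Lemma mconj_tr W M : mconj W M -> \tr M = \tr W.
Proof. by move=> [g hg ->]; rewrite tr_conj // (hecke_det hg). Qed.

Lemma mconj_trmx W M : mconj W M -> mconj W^T M^T.
Proof.
move=> [g hg ->]; have ug := hecke_unit hg.
exists (g^-1)^T; first by apply/hecke_trmx/heckeV.
rewrite !trmx2M mulrA; congr (_ * _).
apply: (mulrI (hecke_unit (hecke_trmx (heckeV hg)))).
rewrite mulrV ?(hecke_unit (hecke_trmx (heckeV hg))) //.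
by rewrite -trmx2M mulrV // [(1)^T]trmx1.
Qed.

Lemma conjmX g N k : g \is a GRing.unit -> (g * N * g^-1) ^+ k = g * N ^+ k * g^-1.
Proof.
move=> ug; elim: k => [|k IH]; first by rewrite !expr0 mulr1 mulrV.
by rewrite !exprS IH !mulrA mulrVK.
Qed.

Lemma mconj_primitive W M : mconj W M -> primitive p W -> primitive p M.
Proof.
move=> /mconj_sym [g hg EW] pW k N hk hN E.
apply: (pW k (g * N * g^-1) hk); first by do !apply: heckeM => //; apply: heckeV.
by rewrite conjmX ?hecke_unit // EW; apply: eqpmMlr.
Qed.

Lemma trmx2X N k : (N ^+ k)^T = N^T ^+ k.
Proof.
elim: k => [|k IH]; first by rewrite !expr0 [(1)^T]trmx1.
by rewrite exprS exprSr -IH; apply: trmx2M.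
Qed.

Lemma primitive_trmx W : primitive p W -> primitive p W^T.
Proof.
move=> pW k N hk hN E; apply: (pW k N^T hk (hecke_trmx hN)).
rewrite -trmx2X -(trmxK W).
by case: E => ->; [left|right]; rewrite // linearN.
Qed.

(** Acting by g on [Qmx N] conjugates N by g^-1, and [Qmx] is injective on matrices of determinant 1
    and positive trace. *)
Lemma assoc_classP W A M : assoc_class p W A -> hecke p W -> 0 < \tr W ->
  hecke p M -> 0 < \tr M -> A (Qmx M) <-> mconj W M.
Proof.
move=> [[Q lQ ->] [M0 [hM0 [h hh E0] t0 [_ [g0 hg0 EQ0]]]]] hW tW hM tM.
have c0 : mconj W M0.
  exists h => //; case: E0 => // E; exfalso; move: t0.
  rewrite E linearN /= tr_conj ?(hecke_det hh) // oppr_gt0 => /(lt_trans tW).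
  by rewrite ltxx.
split=> [[_ [g hg EQ]]|cM].
  (* [Qmx M0] and [Qmx M] arise from [Q] by [g0] and [g], so [g0^-1 * g] carries the first to the
     second. *)
  apply: (mconj_trans c0); exists (g^-1 * g0).
    by apply: heckeM => //; apply: heckeV.
  have hk : hecke p (g0^-1 * g) by apply: heckeM => //; apply: heckeV.
  have -> : (g^-1 * g0)= (g0^-1 * g)^-1.
    by rewrite invrM ?invrK ?unitrV ?hecke_unit.
  rewrite invrK; apply: Qmx_inj; rewrite ?(hecke_det hM) //.
  - by apply: (@hecke_det R p); do !apply: heckeM => //; apply: heckeV; apply: heckeM => //; apply: heckeV.
  - have := @mconj_tr M0 ((g0^-1 * g)^-1 * M0 * (g0^-1 * g)) => -> //.
    by exists (g0^-1 * g)^-1; [exact: heckeV|rewrite invrK].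
  rewrite -bqf_act_Qmx ?(hecke_det hk) // EQ0 bqf_actM mulrA mulrV ?hecke_unit //.
  by rewrite mul1r.
have [k hk EM] := mconj_trans (mconj_sym c0) cM.
split; first exact: hecke_lam_bqf.
exists (g0 * k^-1); first by apply: heckeM => //; apply: heckeV.
have dk := hecke_det (heckeV hk).
by rewrite -bqf_actM -EQ0 bqf_act_Qmx // invrK EM.
Qed.

End Forms.

(** * Poles described by simple numbers, and the effect of transposition *)

Section SimplePoints.
Variables (R : realType) (p : nat).
Hypothesis hp : (3 <= p)%N.
Implicit Types (M N g W : 'M[R]_2) (w u v : seq nat) (x y z a b c : R).

Local Notation T := (Tmx R).
Local Notation V := (gen_prod R p).

(* x is a simple number with Hecke-conjugate y, attracting for a conjugate of W. *)
Definition simple_pair W x y : Prop := exists M a,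
  [/\ mconj p W M, 1 < a, eig M x a, eig M y a^-1 & y < 0 < x].

Lemma simple_pair_mconj W W' x y : mconj p W W' ->
  simple_pair W' x y -> simple_pair W x y.
Proof.
move=> c [M [a [cM h1 h2 h3 h4]]]; exists M, a; split=> //.
exact: mconj_trans c cM.
Qed.

Lemma simple_pair_Hconj W x y : hecke p W -> simple_pair W x y -> Hconj p x y.
Proof.
move=> hW [M [a [cM a1 hx hy yx]]]; apply/Hconj_eig; exists M, a, a^-1.
have xy := sgn_neq yx; split=> //; last by rewrite eq_sym.
  exact: mconj_hecke cM.
rewrite /hyperbolic (eig_tr xy hx hy) ger0_norm; first exact: gt1_inv_add.
by have := gt1_inv_add a1; lra.
Qed.

(** M^T = T M^-1 T^-1, and M^-1 attracts to [y], so M^T attracts to the image of [y] under T. *)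
Lemma simple_pair_trmx W x y : hecke p W -> simple_pair W x y ->
  simple_pair W^T (- y^-1) (- x^-1).
Proof.
move=> hW [M [a [cM a1 hx hy yx]]]; have /andP[y0 x0] := yx.
have dM := hecke_det (mconj_hecke hW cM).
exists M^T, a; rewrite -(Tmx_conjV dM); split=> //.
- by rewrite Tmx_conjV //; apply: mconj_trmx.
- by apply: eig_T; [rewrite lt_eqF|rewrite -[a]invrK; apply: eigV].
- by apply: eig_T; [rewrite gt_eqF|apply: eigV].
- by rewrite oppr_lt0 invr_gt0 x0 oppr_gt0 invr_lt0.
Qed.

Lemma gen_prod_tr_gt0 w : gen_word p w -> 0 < \tr (V w).
Proof. by move=> /(gen_prod_ge R hp) [? ? ? ?]; rewrite tr2E; lra. Qed.

(** Supplies an actual pole. [al] is the larger root of the characteristic polynomial, and the fixed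
    point solves c x + d = [al]. *)
Lemma hyperbolic_gen_pair w : gen_word p w -> hyperbolic (V w) ->
  exists x y, simple_pair (V w) x y.
Proof.
move=> hw; have [ha hb hc hd] := gen_prod_ge R hp hw.
rewrite /hyperbolic ger0_norm ?(ltW (gen_prod_tr_gt0 hw)) // tr2E => ht.
have := det_gen R p w; rewrite det2E.
set a := V w 0 0 in ha ht *; set b := V w 0 1 in hb *.
set c := V w 1 0 in hc *; set d := V w 1 1 in hd ht * => D.
(* From (a - 1)(d - 1) >= 0 and a + d > 2 follows a d > 1, that is b c > 0. *)
have bc : 0 < b * c by nra.
have c0 : 0 < c.
  by rewrite lt_neqAle hc andbT; apply/eqP => E; move: bc; rewrite -E mulr0 ltxx.
have b0 : 0 < b.
  by rewrite lt_neqAle hb andbT; apply/eqP => E; move: bc; rewrite -E mul0r ltxx.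
have cn : c != 0 by rewrite gt_eqF.
pose s := Num.sqrt ((a + d) ^+ 2 - 4).
have s2 : s ^+ 2 = (a + d) ^+ 2 - 4 by rewrite sqr_sqrtr //; nra.
have s0 : 0 < s by rewrite sqrtr_gt0; nra.
pose al := (a + d + s) / 2.
have al1 : 1 < al by rewrite /al; lra.
have Ei : al^-1 = (a + d - s) / 2.
  have al0 : al != 0 by rewrite gt_eqF //; lra.
  apply: (mulfI al0); rewrite divff // /al.
  transitivity (((a + d) ^+ 2 - s ^+ 2) / 4); last by field.
  by rewrite s2; field.
exists ((al - d) / c), ((al^-1 - d) / c), (V w), al; split=> //.
- by exists 1; [exact: hecke1|rewrite mul1r invr1 mulr1].
- rewrite /eig -/a -/b -/c -/d; split; last by field.
  apply: (mulfI cn); transitivity (a * (al - d) + b * c); first by field.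
  have -> : b * c = a * d - 1 by rewrite -D; ring.
  transitivity (al * (al - d)); last by field.
  by rewrite /al; move: s2; lra.
- move: Ei; move: (al^-1) => be Ei; rewrite /eig -/a -/b -/c -/d; split; last by field.
  apply: (mulfI cn); transitivity (a * (be - d) + b * c); first by field.
  have -> : b * c = a * d - 1 by rewrite -D; ring.
  transitivity (be * (be - d)); last by field.
  by rewrite Ei; move: s2; lra.
(* The negative product puts the two fixed points on opposite sides of 0. *)
have P : (al - d) * (al^-1 - d) = - (b * c).
  have -> : b * c = a * d - 1 by rewrite -D; ring.
  by rewrite Ei /al; move: s2; lra.
have L : al^-1 - d < al - d by rewrite Ei /al; lra.
rewrite pmulr_llt0 ?invr_gt0 // divr_gt0 // ?andbT.
  by nra.
by nra.
Qed.

Lemma Zset_simple_pair w A x : gen_word p w -> hyperbolic (V w) ->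
  primitive p (V w) -> assoc_class p (V w) A ->
  Zset p A x <-> exists y, simple_pair (V w) x y.
Proof.
move=> hw hyp prim hA; have tW := gen_prod_tr_gt0 hw; have hW := hecke_gen R p w.
split=> [[[y hxy yx] [M [hM tM hypM primM att] AM]]|[y hxy]].
  have cM := (assoc_classP hA hW tW hM tM).1 AM.
  have dM := hecke_det hM; have [a a1 ha] := (attractingP _ dM).1 att.
  (* The Hecke-conjugate [y] comes from a hyperbolic element that may differ from [M]; still [M]
     fixes it. *)
  have [b hb] := Hconj_stabilizer hp yx hxy hM ha.
  have xy := sgn_neq yx.
  have a0 := eig_neq0 dM ha.
  have Eb : b = a^-1.
    by apply: (mulfI a0); rewrite divff // -dM (eig_det xy ha hb).
  exists y, M, a; split=> //; last by rewrite -Eb.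
  move: tM a1; rewrite (eig_tr xy ha hb) Eb; case: (ltrgtP a 0) a0 => // s _.
    by have : a^-1 < 0 by [rewrite invr_lt0]; lra.
  by rewrite gtr0_norm.
have hc := simple_pair_Hconj hW hxy.
move: hxy => [M [a [cM a1 hx hy yx]]].
split; first by exists y.
have hM := mconj_hecke hW cM.
exists M; last by apply/(assoc_classP hA hW tW hM) => //; rewrite (mconj_tr cM).
split=> //.
- by rewrite (mconj_tr cM).
- by rewrite /hyperbolic (mconj_tr cM).
- exact: mconj_primitive cM prim.
- by apply/(attractingP _ (hecke_det hM)); exists a => //; rewrite gtr0_norm //; lra.
Qed.

(** The ISP with the form class eliminated, so that only the conjugacy class of [W] enters. *)
Definition pole W z : Prop :=
  (exists y, simple_pair W z y) \/
  exists x y, simple_pair W x y /\ z = - x^-1.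

Lemma ISP_pole w A z : gen_word p w -> hyperbolic (V w) ->
  primitive p (V w) -> assoc_class p (V w) A -> ISP p A z <-> pole (V w) z.
Proof.
move=> hw hyp prim hA; have E x := Zset_simple_pair x hw hyp prim hA.
split=> [[/E h|[x /E [y h] <-]]|[/E h|[x [y [h ->]]]]].
- by left.
- by right; exists x, y; rewrite moebiusT.
- by left.
- by right; exists x; [apply/E; exists y|rewrite moebiusT].
Qed.

(** For a simple pair (x, z) of W, the transpose has the positive pole - z^-1. So x' = z is the
    T-image of that pole, and the conjugate of - x^-1 is that pole itself. The converse applies this
    to W^T. *)
Lemma Hconj_pole W y : hecke p W ->
  (exists2 x, pole W x & Hconj p x y) <-> pole W^T y.
Proof.
move=> hW; split.
  move=> [x [[z hz]|[t [z [hz ->]]]] hxy].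
    have yx : z < 0 < x by case: hz => [? [? []]].
    rewrite (Hconj_unique hp yx (simple_pair_Hconj hW hz) hxy).
    right; exists (- z^-1), (- x^-1); split; first exact: simple_pair_trmx.
    by rewrite invrN opprK invrK.
  have yx : z < 0 < t by case: hz => [? [? []]].
  rewrite (Hconj_unique_T hp yx (simple_pair_Hconj hW hz) hxy).
  by left; exists (- t^-1); apply: simple_pair_trmx.
have hWT := hecke_trmx hW.
move=> [[z hz]|[x [z [hz ->]]]].
  have yx : z < 0 < y by case: hz => [? [? []]].
  exists z.
    right; exists (- z^-1), (- y^-1); split; last by rewrite invrN opprK invrK.
    by rewrite -(trmxK W); apply: simple_pair_trmx.
  have /Hconj_eig [M [a [b [? ? ? ? ?]]]] := simple_pair_Hconj hWT hz.
  by apply/Hconj_eig; exists M, b, a; split; rewrite // eq_sym.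
have yx : z < 0 < x by case: hz => [? [? []]].
have /andP[z0 x0] := yx.
exists (- z^-1).
  by left; exists (- x^-1); rewrite -(trmxK W); apply: simple_pair_trmx.
have /Hconj_eig [M [a [b [? ? ? ? ?]]]] := simple_pair_Hconj hWT hz.
apply: Hconj_T; [by rewrite lt_eqF|by rewrite gt_eqF|].
by apply/Hconj_eig; exists M, b, a; split; rewrite // eq_sym.
Qed.

Lemma hyperbolic_nonempty w : hyperbolic (V w) -> w != [::].
Proof.
by case: w => //; rewrite gen_prod_nil /hyperbolic tr2E !one2E ger0_norm ?ltxx.
Qed.

Lemma mconj_rot k w : mconj p (V w) (V (rot k w)).
Proof.
have hg := hecke_gen R p (take k w); have ug := hecke_unit hg.
exists (V (take k w))^-1; first exact: heckeV.
rewrite invrK /rot gen_prod_cat.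
have -> : V w = V (take k w) * V (drop k w) by rewrite -gen_prod_cat cat_take_drop.
by rewrite !mulrA mulVr // mul1r.
Qed.

End SimplePoints.

(** * Comparison of the two pole sets *)

Theorem theorem4p6 (R : realType) (p : nat) (hp : (3 <= p)%N)
  (w1 w2 : seq nat) (hw1 : gen_word p w1) (hw2 : gen_word p w2)
  (hyp1 : hyperbolic (gen_prod R p w1)) (hyp2 : hyperbolic (gen_prod R p w2))
  (prim1 : primitive p (gen_prod R p w1))
  (prim2 : primitive p (gen_prod R p w2))
  (A1 A2 : set (bqf R))
  (hA1 : assoc_class p (gen_prod R p w1) A1)
  (hA2 : assoc_class p (gen_prod R p w2) A2) :
  Hconj_set p (ISP p A1) = ISP p A2 <-> cyclic_perm (word_tr p w1) w2.
Proof.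
have H1 y : Hconj_set p (ISP p A1) y <-> pole p (gen_prod R p (word_tr p w1)) y.
  rewrite gen_prod_tr //; apply: iff_trans (Hconj_pole hp y (hecke_gen R p w1)).
  by split=> -[x /(ISP_pole hp x hw1 hyp1 prim1 hA1) hx hxy]; exists x.
have H2 y := ISP_pole hp y hw2 hyp2 prim2 hA2.
have hw1' := gen_word_tr hw1.
have hyp1' : hyperbolic (gen_prod R p (word_tr p w1)).
  by rewrite gen_prod_tr // /hyperbolic mxtrace_tr.
have prim1' : primitive p (gen_prod R p (word_tr p w1)).
  by rewrite gen_prod_tr //; apply: primitive_trmx.
split=> [E|[k E]].
  have [x [y hxy]] := hyperbolic_gen_pair hp hw1' hyp1'.
  have : ISP p A2 x by rewrite -E; apply/H1; left; exists y.
  move: hxy => [M [a [cM a1 hx hy yx]]]; have /andP[_ x0] := yx.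
  (* The common pole [x] is positive, so it is not a T-image of a simple number. *)
  move=> /H2 [[z [N [b [cN b1 hx' hz zx]]]]|[t [z [[N [b [_ _ _ _ /andP[_ t0]]]] Ex]]]]; last first.
    by move: x0; rewrite Ex oppr_gt0 invr_lt0 => /(lt_trans t0); rewrite ltxx.
  (* A single common attracting point identifies the primitive elements, so the two generator
     products are conjugate. *)
  have EMN : M = N.
    apply: (primitive_eig_unique hp _ _ _ _ a1 b1 yx zx hx hy hx' hz).
    - exact: mconj_hecke (hecke_gen _ _ _) cM.
    - exact: mconj_hecke (hecke_gen _ _ _) cN.
    - exact: mconj_primitive cM prim1'.
    - exact: mconj_primitive cN prim2.
  rewrite -EMN in cN; have [g hg Eg] := mconj_trans cN (mconj_sym cM).
  apply: (conj_gen_prod_rot hp _ _ hw1' hw2 hg); rewrite ?(@hyperbolic_nonempty R p) //.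
  by left; rewrite Eg mulrVK // (hecke_unit hg).
(* Rotating a word conjugates its product by a prefix, and conjugate elements have the same
   poles. *)
have c := mconj_rot R p k w2; rewrite -E in c.
have P z : pole p (gen_prod R p (word_tr p w1)) z <-> pole p (gen_prod R p w2) z.
  split=> -[[y h]|[x [y [h ->]]]].
  - by left; exists y; apply: simple_pair_mconj h.
  - by right; exists x, y; split=> //; apply: simple_pair_mconj h.
  - by left; exists y; apply: simple_pair_mconj h; apply: mconj_sym.
  - by right; exists x, y; split=> //; apply: simple_pair_mconj h; apply: mconj_sym.
apply/seteqP; split=> z.
  by move=> /H1 /P /H2.
by move=> /H2 /P /H1.
Qed.
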